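(* Let $A\in\mathbb{R}^{d\times n}$ have rank $d$ and no zero columns, and let $\mathcal{B}\subseteq\mathcal{C}(A)$ be a subset of the set of circuits. The corresponding set of circuit polynomials $\{h_v: v\in\mathcal{B}\}$ cuts out the reciprocal plane $\mathcal{L}^{-1}$ set-theoretically (i.e. the common zero set of these polynomials in $\mathbb{P}^{n-1}$ equals $\mathcal{L}^{-1}$) if and only if $\mathcal{B}$ exposes every non-flat of $M(A)$, i.e. every non-flat is exposed by some $v\in\mathcal{B}$.
   Context: $\mathcal{L}\subset\mathbb{C}^n$ is the row space of $A$, and the reciprocal plane $\mathcal{L}^{-1}\subset\mathbb{P}^{n-1}$ (complex projective space) is the Zariski closure of $\{(1/u_1:\dots:1/u_n): u\in\mathcal{L}\cap(\mathbb{C}^* )^n\}$. $M(A)$ is the matroid on $[n]$ of the columns $A_1,\dots,A_n$ of $A$. A circuit is an inclusion-minimal dependent subset of $[n]$; each circuit $C$ is identified with a chosen vector $v\in\mathbb{R}^n$ in $\ker A$ with $\mathrm{supp}(v)=C$, and $\mathcal{C}(A)$ is the set of these representatives. The circuit polynomial of $v$ is $h_v(\mathbf{x})=\sum_{i\in\mathrm{supp}(v)}v_i\prod_{j\in\mathrm{supp}(v)\setminus\{i\}}x_j$. A set $J\subseteq[n]$ is a flat if $J=\{i:A_i\in\mathrm{span}(A_j:j\in J)\}$, equivalently $|J^c\cap\mathrm{supp}(v)|\neq 1$ for every $v\in\mathcal{C}(A)$, where $J^c=[n]\setminus J$. A non-flat $J\subset[n]$ is exposed by a circuit $v\in\mathcal{C}(A)$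 if $|J^c\cap\mathrm{supp}(v)|=1$. *)

(* Defs.v *)
From HB Require Import structures.
From mathcomp Require Import all_boot all_order all_algebra.
From mathcomp Require Import boolp classical_sets reals.
From mathcomp Require Import complex.
From mathcomp Require Import mpoly.

Set Implicit Arguments.
Unset Strict Implicit.
Unset Printing Implicit Defensive.

Import Order.TTheory GRing.Theory Num.Theory.

Local Open Scope ring_scope.

(* The projective space P^(n-1) over K, as the set of lines of K^n. *)
Definition proj (K : fieldType) (n : nat) : Type :=
  {L : {vspace 'rV[K]_n} | \dim L == 1%N}.

(* P is a zero of p when p vanishes at all homogeneous coordinate vectors of
   P (and at 0).  For p homogeneous of positive degree this only has to be
   tested at one coordinate vector; a nonzero constant has no zero. *)
Definition proj_zero (K : fieldType) (n : nat) (p : {mpoly K[n]})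
    (P : proj K n) : Prop :=
  forall x : 'rV[K]_n, x \in val P -> p.@[fun i => x 0 i] = 0.

Definition zero_locus (K : fieldType) (n : nat) (S : set {mpoly K[n]}) :
    set (proj K n) :=
  fun P => forall p, S p -> proj_zero p P.

Definition zariski_closed (K : fieldType) (n : nat) (Z : set (proj K n)) : Prop :=
  exists2 S : set {mpoly K[n]},
    (forall p, S p -> exists d : nat, p \is d.-homog) & Z = zero_locus S.

Definition zariski_closure (K : fieldType) (n : nat) (S : set (proj K n)) :
    set (proj K n) :=
  smallest (@zariski_closed K n) S.

Definition complexify (R : realType) (m n : nat) (A : 'M[R]_(m, n)) :
    'M[R[i]]_(m, n) :=
  map_mx (real_complex R) A.

(* The points (1/u_1 : ... : 1/u_n), for u in the complex row space of A with
   all coordinates nonzero. *)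
Definition reciprocal_points (R : realType) (d n : nat) (A : 'M[R]_(d, n)) :
    set (proj R[i] n) :=
  fun P => exists u : 'rV[R[i]]_n,
    [/\ (u <= complexify A)%MS,
        forall i, u 0 i != 0
      & val P = <[(\row_i (u 0 i)^-1)%R]>%VS].

Definition reciprocal_plane (R : realType) (d n : nat) (A : 'M[R]_(d, n)) :
    set (proj R[i] n) :=
  zariski_closure (reciprocal_points A).

(* The sequence of columns keeps repetitions: two equal columns with distinct
   indices are dependent. *)
Definition dependent (K : fieldType) (d n : nat) (A : 'M[K]_(d, n)) :
    pred {set 'I_n} :=
  fun S => ~~ free [seq col j A | j in S].

Definition circuit (K : fieldType) (d n : nat) (A : 'M[K]_(d, n)) :
    pred {set 'I_n} :=
  fun C => minset (dependent A) C.

Definition supp (K : fieldType) (n : nat) (v : 'cV[K]_n) : {set 'I_n} :=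
  [set i | v i 0 != 0]%SET.

(* rep chooses, for each circuit C, a vector of ker A with support C; its
   values at other sets are irrelevant. *)
Definition circuit_choice (K : fieldType) (d n : nat) (A : 'M[K]_(d, n))
    (rep : {set 'I_n} -> 'cV[K]_n) : Prop :=
  forall C, circuit A C -> A *m rep C = 0 /\ supp (rep C) = C.

Definition circuit_vectors (K : fieldType) (d n : nat) (A : 'M[K]_(d, n))
    (rep : {set 'I_n} -> 'cV[K]_n) : set 'cV[K]_n :=
  fun v => exists2 C, circuit A C & v = rep C.

Definition circuit_poly (R : realType) (n : nat) (v : 'cV[R]_n) :
    {mpoly R[i][n]} :=
  \sum_(i in supp v) (v i 0)%:C%C *: \prod_(j in supp v :\ i) 'X_j.

Definition circuit_polys (R : realType) (n : nat) (B : set 'cV[R]_n) :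
    set {mpoly R[i][n]} :=
  fun p => exists2 v, B v & p = circuit_poly v.

Definition flat (K : fieldType) (d n : nat) (A : 'M[K]_(d, n)) :
    pred {set 'I_n} :=
  fun J => J == [set i | col i A \in <<[seq col j A | j in J]>>%VS]%SET.

Definition exposes (K : fieldType) (n : nat) (v : 'cV[K]_n) (J : {set 'I_n}) :
    bool :=
  #|~: J :&: supp v| == 1%N.

(* Main.v *)
Require Import Defs.
From HB Require Import structures.
From mathcomp Require Import all_boot all_order all_algebra.
From mathcomp Require Import boolp classical_sets reals.
From mathcomp Require Import complex.
From mathcomp Require Import mpoly.
From mathcomp Require Import ring.

(* Let x be a common zero of the circuit polynomials in B, with support J.  If J
   were not a flat, a circuit v of B exposing J would have h_v(x) equal to a
   single nonzero term.  So J is a flat, and the circuits of B inside J, which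
   still expose the non-flats inside J, force 1/x on J to extend to some w in
   L.  Choosing u in L whose zero set is J, the points 1/(u + s w) of the
   reciprocal plane tend projectively to x as s tends to 0.
   Conversely, if no circuit of B exposes the non-flat J, take u in L without
   zero coordinates: the point equal to 1/u on J and to 0 elsewhere is a zero
   of every h_v with v in B, whereas h_v does not vanish there for a kernel
   vector v exposing J. *)

Set Implicit Arguments.
Unset Strict Implicit.
Unset Printing Implicit Defensive.

Import Order.TTheory GRing.Theory Num.Theory.

Local Open Scope ring_scope.

(** * Polynomial curves in place of limits *)

Lemma poly_neq0_nonroot (K : numDomainType) (p : {poly K}) :
  p != 0 -> exists s, p.[s] != 0.
Proof.
(* In characteristic zero these are [size p] distinct points, more than [p] can have as roots. *)
move=> p0; pose rs := [seq (i%:R : K) | i <- iota 0 (size p)].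
have urs : uniq rs.
  by rewrite map_inj_uniq ?iota_uniq // => i j /eqP; rewrite eqr_nat => /eqP.
have : ~~ all (root p) rs.
  apply/negP => /(max_poly_roots p0)/(_ urs).
  by rewrite size_map size_iota ltnn.
by case/allPn => s _ ps; exists s.
Qed.

Lemma horner_mmap (K : comNzRingType) n (p : {mpoly K[n]})
    (y : 'I_n -> {poly K}) s :
  (mmap (@polyC K) y p).[s] = p.@[fun i => (y i).[s]].
Proof.
rewrite mevalE /mmap horner_sum; apply: eq_bigr => m _.
rewrite hornerM hornerC /mmap1 horner_prod; congr (_ * _).
by apply: eq_bigr => i _; rewrite horner_exp.
Qed.

(* Where [x] is nonzero, [s / (u + s w)] is constantly [x]; elsewhere it tends
   to [0 = x] with [s].  Clearing denominators makes the curve polynomial, so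
   that no topology is needed. *)
Lemma meval_recip_limit (K : numFieldType) n (p : {mpoly K[n]})
    (x u w : 'I_n -> K) a :
  (forall i, x i != 0 -> u i = 0 /\ w i * x i = 1) ->
  (forall i, x i = 0 -> u i != 0) ->
  (forall s c, (forall i, u i + s * w i != 0) ->
     p.@[fun i => c * (u i + s * w i)^-1] = 0) ->
  p.@[fun i => a * x i] = 0.
Proof.
move=> hw hu hp.
pose D j : {poly K} := (u j)%:P + w j *: 'X.
have DE j s : (D j).[s] = u j + s * w j.
  by rewrite /D hornerD hornerC hornerZ hornerX mulrC.
pose Q : {poly K} := \prod_(j | x j == 0) D j.
pose q := \prod_(j | x j == 0) u j.
have q0 : q != 0 by apply/prodf_neq0 => j /eqP /hu.
have Q0 : Q.[0] = q.
  by rewrite horner_prod; apply: eq_bigr => j _; rewrite DE mul0r addr0.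
(* Both branches are [a * q^-1 * s * Q.[s] / (u i + s * w i)] with the denominator cancelled; when
   [x i != 0] it equals [s / x i]. Dividing by [q = Q.[0]] makes the value at [s = 0] equal to
   [a * x i]. *)
pose y i : {poly K} := if x i != 0 then (a * q^-1 * x i)%:P * Q
            else (a * q^-1)%:P * ('X * \prod_(j | (x j == 0) && (j != i)) D j).
pose g := mmap (@polyC K) y p.
have g0 : g = 0.
  apply/eqP/contraT => gn0.
  have Qn0 : Q != 0 by apply: contra_neq q0 => Qz; rewrite -Q0 Qz horner0.
  (* The factor ['X * Q] keeps [s] away from 0 and from the roots of every [D i]. *)
  have [s] : exists s, (g * ('X * Q)).[s] != 0.
    by apply: poly_neq0_nonroot; rewrite !mulf_neq0 ?polyX_eq0.
  rewrite !hornerM hornerX !mulf_eq0 !negb_or => /and3P[gs s0 Qs].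
  have Ds i : u i + s * w i != 0.
    have [xi|xi] := eqVneq (x i) 0.
      move: Qs; rewrite horner_prod => /prodf_neq0/(_ i).
      by rewrite xi eqxx DE; apply.
    have [-> wx] := hw _ xi; rewrite add0r mulf_neq0 //.
    by apply/eqP => w0; move: wx; rewrite w0 mul0r => /eqP; rewrite eq_sym oner_eq0.
  case/eqP: gs; rewrite horner_mmap -(hp s (a * s * Q.[s] * q^-1) Ds).
  apply: meval_eq => i; apply: (canRL (mulfK (Ds i))); rewrite /y.
  have [xi|xi] /= := eqVneq (x i) 0.
    rewrite !hornerM hornerC hornerX -DE /Q [in RHS](bigD1 i) ?xi //= hornerM; ring.
  have [-> wx] := hw _ xi; rewrite hornerM hornerC add0r.
  by transitivity (a * q^-1 * Q.[s] * s * (w i * x i)); [|rewrite wx]; ring.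
have := horner_mmap p y 0; rewrite -/g g0 horner0 => /esym <-.
apply: meval_eq => i; rewrite /y.
have [xi|xi] /= := eqVneq (x i) 0; first by rewrite xi !hornerM hornerX mul0r !mulr0.
by rewrite hornerM hornerC Q0 mulrAC divfK.
Qed.

(** * Column spans, flats and kernel vectors *)

Section ColumnSpans.

Variables (K : fieldType) (d n : nat) (A : 'M[K]_(d, n)).
Implicit Types (S J : {set 'I_n}) (i j : 'I_n) (w : 'cV[K]_d).

Definition colspan (S : {set 'I_n}) : {vspace 'cV[K]_d} :=
  <<[seq col j A | j in S]>>%VS.

Lemma mulmx_cols (c : 'cV[K]_n) : A *m c = \sum_j c j 0 *: col j A.
Proof.
apply/colP => i; rewrite mxE summxE; apply: eq_bigr => j _.
by rewrite !mxE mulrC.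
Qed.

Lemma mem_colspan S j : j \in S -> col j A \in colspan S.
Proof. by move=> jS; apply/memv_span/fintype.image_f. Qed.

Lemma colspanP S w :
  w \in colspan S ->
  exists2 c : 'cV[K]_n, (forall j, j \notin S -> c j 0 = 0) & w = A *m c.
Proof.
(* The image of the linear map [c |-> A *m mask c] is a subspace containing the columns in [S],
   hence their span. *)
pose mask (c : 'cV[K]_n) : 'cV[K]_n := \col_j (if j \in S then c j 0 else 0).
pose f (c : 'cV[K]_n) := A *m mask c.
have lf : linear f.
  move=> a b c; rewrite /f scalemxAr -mulmxDr; congr (_ *m _).
  by apply/colP => j; rewrite !mxE; case: ifP => // _; rewrite mulr0 addr0.
pose LF := GRing.isLinear.Build K _ _ _ f lf.
pose F : {linear 'cV[K]_n -> 'cV[K]_d} := HB.pack f LF.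
suff /subvP sub : (colspan S <= limg (linfun F))%VS.
  move=> /sub /memv_imgP[c _ ->]; exists (mask c).
    by move=> j /negPf jS; rewrite mxE jS.
  by rewrite lfunE.
apply/span_subvP => _ /fintype.imageP[j jS ->].
apply/memv_imgP; exists (delta_mx j 0); rewrite ?memvf // lfunE /= /f.
rewrite mulmx_cols (bigD1 j) //= big1 => [|k kj]; rewrite !mxE ?jS ?eqxx.
  by rewrite scale1r addr0.
by rewrite (negPf kj) if_same scale0r.
Qed.

Lemma colspan_circuit S i (v : 'cV[K]_n) :
  A *m v = 0 -> supp v :\: S = [set i] -> col i A \in colspan S.
Proof.
move=> Av sv.
have vi : v i 0 != 0.
  by have := finset.set11 i; rewrite -sv !inE => /andP[].
suff -> : col i A = \sum_(j | j != i) (- (v i 0)^-1 * v j 0) *: col j A.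
  apply: rpred_sum => j ji; have [jS|jS] := boolP (j \in S).
    exact/rpredZ/mem_colspan.
  have : j \notin supp v :\: S by rewrite sv inE.
  rewrite !inE jS /= negbK => /eqP ->.
  by rewrite mulr0 scale0r rpred0.
have := mulmx_cols v; rewrite Av (bigD1 i) //= => /esym/eqP.
rewrite addr_eq0 => /eqP /(congr1 (GRing.scale (v i 0)^-1)).
rewrite scalerA mulVf // scale1r => ->.
rewrite scalerN -scaleNr scaler_sumr.
by apply: eq_bigr => j _; rewrite scalerA.
Qed.

(** Linear duality: some functional kills the subspace but not a vector outside it. It supplies
    vectors of the row space with prescribed zeros. *)
Lemma colspan_separation S i :
  col i A \notin colspan S ->
  exists2 x : 'rV[K]_d,
    forall j, j \in S -> (x *m A) 0 j = 0 & (x *m A) 0 i != 0.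
Proof.
set w := col i A; pose M : 'M[K]_(n, d) := \matrix_(j, k) if j \in S then A k j else 0.
have [|wM _] := boolP (w^T <= M)%MS.
  case/submxP => D wD /negP[].
  have -> : w = \sum_(j in S) D 0 j *: col j A.
    rewrite -[w]trmxK wD; apply/colP => k.
    rewrite mxE mxE summxE [RHS]big_mkcond /=; apply: eq_bigr => j _.
    by rewrite !mxE; case: ifP; rewrite ?mulr0.
  by apply: rpred_sum => j jS; apply/rpredZ/mem_colspan.
have [k wk] : exists k, (w^T *m cokermx M) 0 k != 0.
  apply/existsP; rewrite -negb_forall.
  apply: contra wM => /forallP wk0.
  by rewrite submxE; apply/eqP/rowP => k; rewrite (eqP (wk0 k)) mxE.
move: (cokermx M) (mulmx_coker M) wk => N MN wk.
exists (col k N)^T => [j jS|].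
  have := MN => /matrixP/(_ j k); rewrite !mxE => MNjk.
  by rewrite -[RHS]MNjk; apply: eq_bigr => l _; rewrite !mxE jS mulrC.
apply: contra_neq wk; rewrite !mxE => xi; rewrite -[RHS]xi.
by apply: eq_bigr => l _; rewrite !mxE mulrC.
Qed.

Lemma flatE J i : flat A J -> (i \in J) = (col i A \in colspan J).
Proof. by move/eqP => {1}->; rewrite inE. Qed.

Lemma nonflatP J :
  reflect (exists2 i, i \notin J & col i A \in colspan J) (~~ flat A J).
Proof.
apply: (iffP idP) => [nf|[i iJ iA]]; last first.
  by apply: contra iJ => fJ; rewrite (flatE _ fJ).
have [i /andP[iJ iA]|no] := pickP (fun i => (i \notin J) && (col i A \in colspan J)).
  by exists i.
case/negP: nf; apply/eqP/setP => i; rewrite inE.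
apply/idP/idP => [/mem_colspan //|iA].
by have := no i; rewrite iA andbT => /negbFE.
Qed.

(** Subtract from column [i] its expression by columns of [J]. A kernel vector suffices here,
    circuit or not, since its polynomial already vanishes on the reciprocal plane. *)
Lemma nonflat_kernel J :
  ~~ flat A J -> exists2 v : 'cV[K]_n, A *m v = 0 & exposes v J.
Proof.
case/nonflatP => i iJ /colspanP[c cJ ci].
exists (delta_mx i 0 - c); first by rewrite mulmxBr -ci -colE subrr.
apply/cards1P; exists i; apply/setP => j; rewrite !inE !mxE eqxx andbT.
have [->|ji] := eqVneq j i; first by rewrite iJ (cJ _ iJ) subr0 oner_neq0.
by case: (boolP (j \in J)) => //= /cJ ->; rewrite subrr eqxx.
Qed.

End ColumnSpans.

(* The curve [\sum_k s ^ k * u_k], with [u_k] nonzero at [k], lies in no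
   coordinate hyperplane indexed by [S]. *)
Lemma generic_vector (K : numFieldType) m n (V : 'M[K]_(m, n)) (S : {set 'I_n}) :
  (forall i, i \in S -> exists2 u : 'rV[K]_n, (u <= V)%MS & u 0 i != 0) ->
  exists2 u : 'rV[K]_n, (u <= V)%MS & forall i, i \in S -> u 0 i != 0.
Proof.
move=> hS.
have /choice[f hf] i : exists u : 'rV[K]_n,
    (u <= V)%MS /\ (i \in S -> u 0 i != 0).
  have [/hS[u uV ui]|_] := boolP (i \in S); first by exists u.
  by exists 0; split; first exact: sub0mx.
pose p i : {poly K} := \sum_(k < n) (f k 0 i) *: 'X^k.
have pE i s : (p i).[s] = (\sum_(k < n) s ^+ k *: f k) 0 i.
  rewrite horner_sum summxE; apply: eq_bigr => k _.
  by rewrite hornerZ hornerXn mxE mulrC.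
have p0 i : i \in S -> p i != 0.
  move=> /(proj2 (hf i)); apply: contra_neq => pi0.
  (* The coefficient of ['X^i] in [p i] is the [i]-th coordinate of [f i]. *)
  have /(congr1 (fun q : {poly K} => q`_i)) := pi0; rewrite coef0 coef_sum.
  rewrite (bigD1 i) //= coefZ coefXn eqxx mulr1 big1 ?addr0 // => k ki.
  by rewrite coefZ coefXn eq_sym (inj_eq val_inj) (negPf ki) mulr0.
have [s] : exists s, (\prod_(i in S) p i).[s] != 0.
  by apply: poly_neq0_nonroot; apply/prodf_neq0.
rewrite horner_prod => /prodf_neq0 hs.
exists (\sum_(k < n) s ^+ k *: f k).
  by apply: summx_sub => k _; apply/scalemx_sub; case: (hf k).
by move=> i iS; rewrite -pE; apply: hs.
Qed.

(** * Vectors of the complex row space with prescribed coordinates *)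

Section RowSpace.

Variables (R : realType) (d n : nat) (A : 'M[R]_(d, n)).

Let L := complexify A.
Implicit Types (J : {set 'I_n}).

Lemma complexify_sub (x : 'rV[R]_d) :
  (map_mx (real_complex R) (x *m A) <= L)%MS.
Proof. by rewrite map_mxM submxMl. Qed.

Lemma complexify_orthogonal (u : 'rV[R[i]]_n) (v : 'cV[R]_n) :
  (u <= L)%MS -> A *m v = 0 -> \sum_i (v i 0)%:C%C * u 0 i = 0.
Proof.
move=> /submxP[D ->] Av.
have : D *m L *m map_mx (real_complex R) v = 0.
  by rewrite -mulmxA -map_mxM Av map_mx0 mulmx0.
move/matrixP/(_ 0 0); rewrite [LHS]mxE [RHS]mxE => uv; rewrite -[RHS]uv.
by apply: eq_bigr => i _; rewrite [RHS]mulrC; congr (_ * _); rewrite mxE.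
Qed.

(** For [i] outside the flat [J], separation gives a vector of [L] vanishing on [J] but not at [i].
    A generic vector of the subspace of [L] vanishing on [J] then works for all such [i] at once. *)
Lemma generic_vector_flat J : flat A J ->
  exists2 u : 'rV[R[i]]_n, (u <= L)%MS & forall i, (u 0 i == 0) = (i \in J).
Proof.
move=> fJ; pose P : 'M[R[i]]_n := diag_mx (\row_i (i \in J)%:R).
have P0 (u : 'rV[R[i]]_n) :
    (u *m P == 0) = [forall (i | i \in J), u 0 i == 0].
  apply/eqP/forall_inP => [/rowP uP i iJ|uJ]; last apply/rowP => i.
    by have := uP i; rewrite mul_mx_diag !mxE iJ mulr1 => ->.
  rewrite mul_mx_diag !mxE; case: (boolP (i \in J)) => [/uJ/eqP->|_].
    by rewrite mul0r.
  by rewrite mulr0.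
have [i|u] := @generic_vector _ _ _ (L :&: kermx P)%MS (~: J).
  rewrite inE (flatE _ fJ) => /colspan_separation[x xJ xi].
  exists (map_mx (real_complex R) (x *m A)).
    rewrite sub_capmx complexify_sub sub_kermx P0.
    by apply/forall_inP => j /xJ xj; rewrite mxE xj rmorph0.
  by rewrite mxE fmorph_eq0.
rewrite sub_capmx sub_kermx P0 => /andP[uL /forall_inP uJ] uJ'.
exists u => // i; apply/idP/idP => [|/uJ//].
by apply: contraLR => iJ; apply: uJ'; rewrite inE.
Qed.

Lemma flat_set0 : (forall j, col j A != 0) -> flat A finset.set0.
Proof.
move=> A0; rewrite -[flat _ _]negbK; apply/nonflatP; case=> i _ /colspanP[c c0 ci].
case/eqP: (A0 i); rewrite ci (_ : c = 0) ?mulmx0 //.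
by apply/colP => j; rewrite mxE c0 ?inE.
Qed.

(* A vector of [L] agreeing with [y] on as much of [J] as possible agrees on a
   set [K] that spans [J]; if [K <> J] then [K] is not a flat, and a kernel
   vector exposing [K] forces one more coordinate to agree. *)
Lemma row_space_extension (B : set 'cV[R]_n) (J : {set 'I_n})
    (y : 'I_n -> R[i]) :
  (forall v, B v -> A *m v = 0) ->
  (forall K, ~~ flat A K -> exists2 v, B v & exposes v K) ->
  flat A J ->
  (forall v, B v -> supp v \subset J -> \sum_i (v i 0)%:C%C * y i = 0) ->
  exists2 w : 'rV[R[i]]_n, (w <= L)%MS & forall i, i \in J -> w 0 i = y i.
Proof.
move=> kerB expB fJ orth.
pose agree (K : {set 'I_n}) := K \subset J /\
  exists2 w : 'rV[R[i]]_n, (w <= L)%MS & forall i, i \in K -> w 0 i = y i.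
have agree0 : `[< agree finset.set0 >].
  apply/asboolP; split; first exact: finset.sub0set.
  by exists 0 => [|i]; rewrite ?sub0mx ?inE.
have [K /maxsetP[/asboolP[KJ [w wL wK]] maxK] _] :=
  maxset_exists (P := fun K => `[< agree K >]) agree0.
have extend i : i \in J -> (exists2 w' : 'rV[R[i]]_n, (w' <= L)%MS &
    forall j, j \in i |: K -> w' 0 j = y j) -> i \in K.
  move=> iJ wi; rewrite -(maxK (i |: K)) ?finset.setU11 ?finset.subsetUr //.
  by apply/asboolP; split=> //; rewrite finset.subUset finset.sub1set iJ.
have JK i : i \in J -> col i A \in colspan A K.
  move=> iJ; apply: contraT => iK.
  have [x xK xi] := colspan_separation iK.
  suff /(mem_colspan A) : i \in K by rewrite (negPf iK).
  apply: extend => //.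
  pose x' := map_mx (real_complex R) (x *m A).
  have xi' : x' 0 i != 0.
    by rewrite mxE fmorph_eq0.
  (* Since [x'] vanishes on [K], coordinate [i] is corrected without disturbing those in [K]. *)
  exists (w + ((y i - w 0 i) / x' 0 i) *: x').
    by rewrite addmx_sub ?scalemx_sub ?complexify_sub.
  move=> j; rewrite !inE => /orP[/eqP->|jK].
    by rewrite [LHS]mxE [X in _ + X]mxE divfK // addrC subrK.
  by rewrite [LHS]mxE [X in _ + X]mxE [X in _ * X]mxE xK // rmorph0 mulr0 addr0 wK.
suff JKs : {subset J <= K} by exists w => // i /JKs/wK.
move=> i iJ; apply: contraT => iK.
have [v vB /cards1P[k]] : exists2 v, B v & exposes v K.
  by apply: expB; apply/nonflatP; exists i => //; apply: JK.
rewrite finset.setIC -finset.setDE => sv.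
have KJs : (colspan A K <= colspan A J)%VS.
  by apply/span_subvP => _ /fintype.imageP[j jK ->]; apply/mem_colspan/(fintype.subsetP KJ).
(* Flatness of [J] keeps the exposed index inside [J], so [orth] will apply to [v]. *)
have kJ : k \in J.
  by rewrite (flatE _ fJ) (subvP KJs) // (colspan_circuit (kerB v vB) sv).
have svJ j : j \in supp v -> j != k -> j \in K.
  move=> jv jk; apply: contraT => jK.
  have : j \in supp v :\: K by rewrite finset.in_setD jK.
  by rewrite sv finset.in_set1 (negPf jk).
have kv : v k 0 != 0 by have := finset.set11 k; rewrite -sv !inE => /andP[].
suff kK : k \in K by have := finset.set11 k; rewrite -sv inE kK.
apply: extend => //; exists w => // j; rewrite !inE => /orP[/eqP->|/wK//].
have vJ : supp v \subset J.
  apply/fintype.subsetP => l lv; have [->//|lk] := eqVneq l k.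
  exact/(fintype.subsetP KJ)/svJ.
(* Both [w] and [y] are orthogonal to [v] and agree on its support away from [k], hence also at
   [k]. *)
have : \sum_l (v l 0)%:C%C * (w 0 l - y l) = 0.
  under eq_bigr do rewrite mulrBr.
  by rewrite sumrB complexify_orthogonal ?kerB // orth // subrr.
rewrite (bigD1 k) //= big1 => [|l lk]; last first.
  have [lv|] := boolP (l \in supp v); first by rewrite wK ?subrr ?mulr0 ?svJ.
  by rewrite inE negbK => /eqP ->; rewrite mul0r.
by rewrite addr0 => /eqP; rewrite mulf_eq0 fmorph_eq0 (negPf kv) subr_eq0 => /eqP.
Qed.

End RowSpace.

(** * Values of circuit polynomials *)

Section CircuitPolynomials.

Variables (R : realType) (n : nat).
Implicit Types (v : 'cV[R]_n) (x u : 'I_n -> R[i]).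

Lemma circuit_poly_eval v x : (circuit_poly v).@[x] =
  \sum_(i in supp v) (v i 0)%:C%C * \prod_(j in supp v :\ i) x j.
Proof.
rewrite raddf_sum; apply: eq_bigr => i _ /=; rewrite mevalZ rmorph_prod /=.
by congr (_ * _); apply: eq_bigr => j _; rewrite mevalXU.
Qed.

Lemma circuit_poly_homog v : circuit_poly v \is #|supp v|.-1.-homog.
Proof.
apply: rpred_sum => i iv; apply: rpredZ.
rewrite (cardsD1 i) iv add1n /= -sum1_card.
apply: (big_ind2 (fun (p : {mpoly R[i][n]}) m => p \is m.-homog)).
- exact: dhomog1.
- by move=> p k q l; apply: dhomogM.
by move=> j _; rewrite dhomogX /= mdeg1.
Qed.

Lemma circuit_poly_scale v x c : (circuit_poly v).@[fun i => c * x i] =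
  c ^+ #|supp v|.-1 * (circuit_poly v).@[x].
Proof.
rewrite !circuit_poly_eval mulr_sumr; apply: eq_bigr => i iv.
by rewrite big_split /= prodr_const (cardsD1 i (supp v)) iv add1n /= mulrCA.
Qed.

(** Omitting the factor [x i] from the full product amounts to multiplying it by [u i], the inverse
    of [x i]. *)
Lemma circuit_poly_recip v x u : (forall i, i \in supp v -> x i * u i = 1) ->
  (circuit_poly v).@[x] =
  (\prod_(i in supp v) x i) * \sum_i (v i 0)%:C%C * u i.
Proof.
move=> xu; rewrite circuit_poly_eval [X in _ = _ * X](bigID (mem (supp v))) /=.
rewrite [X in _ + X]big1 ?addr0 => [|i]; last first.
  by rewrite inE negbK => /eqP ->; rewrite mul0r.
rewrite mulr_sumr; apply: eq_bigr => i iv.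
by rewrite [RHS]mulrCA [in RHS](big_setD1 i) //= [_ * u i]mulrAC xu // mul1r.
Qed.

(** Only the summand omitting the single zero coordinate in the support survives. *)
Lemma circuit_poly_exposed v x (J : {set 'I_n}) :
  exposes v J -> (forall i, (x i == 0) = (i \notin J)) ->
  (circuit_poly v).@[x] != 0.
Proof.
move=> /cards1P; case=> i; rewrite finset.setIC -finset.setDE => sv xJ.
have iv : i \in supp v :\: J by rewrite sv finset.set11.
have /andP[iJ vi] : (i \notin J) && (i \in supp v) by rewrite -finset.in_setD.
have svJ j : j \in supp v -> j != i -> j \in J.
  move=> jv jk; apply: contraT => jJ.
  have : j \in supp v :\: J by rewrite finset.in_setD jJ.
  by rewrite sv finset.in_set1 (negPf jk).
rewrite circuit_poly_eval (bigD1 i) //= [X in _ + X]big1 ?addr0 => [|k /andP[kv ki]].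
  rewrite mulf_neq0 //; first by rewrite fmorph_eq0; rewrite inE in vi.
  by apply/prodf_neq0 => j; rewrite finset.in_setD1 xJ negbK => /andP[ji jv]; apply: svJ.
rewrite (bigD1 i) /=; last by rewrite finset.in_setD1 eq_sym ki.
by move/eqP: (xJ i); rewrite iJ => /eqP/eqP ->; rewrite mul0r mulr0.
Qed.

(** If the support leaves [J], it does so at two or more indices, and each summand omits only one of
    these zero coordinates. *)
Lemma circuit_poly_unexposed v x u (J : {set 'I_n}) :
  ~~ exposes v J -> (forall i, i \notin J -> x i = 0) ->
  (forall i, i \in J -> x i * u i = 1) ->
  \sum_i (v i 0)%:C%C * u i = 0 ->
  (circuit_poly v).@[x] = 0.
Proof.
move=> nexp x0 xu vu.
have [svJ|] := boolP (supp v \subset J).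
  by rewrite (circuit_poly_recip (u := u)) ?vu ?mulr0 // => i /(fintype.subsetP svJ)/xu.
case/fintype.subsetPn => k kv kJ.
rewrite circuit_poly_eval big1 // => i iv.
have [l /and3P[lv lJ li]] : exists l, [&& l \in supp v, l \notin J & l != i].
  have [ki|ki] := eqVneq k i; last by exists k; rewrite kv kJ.
  apply/existsP; apply: contraR nexp => /existsPn no.
  apply/cards1P; exists i; apply/finset.setP => l.
  rewrite -ki in no *; rewrite finset.in_setI finset.in_setC finset.in_set1.
  have [->|lk] := eqVneq l k; first by rewrite kJ kv.
  by have := no l; rewrite lk andbT andbC => /negPf.
by rewrite (bigD1 l) /= ?x0 ?mul0r ?mulr0 // finset.in_setD1 li.
Qed.

End CircuitPolynomials.

(** * Points of projective space and their generators *)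

Section ProjectivePoints.

Variables (K : fieldType) (n : nat).
Implicit Types (P : proj K n) (x : 'rV[K]_n).

Lemma proj_generator P : exists2 x, x != 0 & val P = <[x]>%VS.
Proof.
case: P => U /= dimU; exists (vpick U).
  by rewrite vpick0 -dimv_eq0 (eqP dimU).
apply/esym/eqP; rewrite eqEdim -memvE memv_pick (eqP dimU) dim_vline.
by rewrite vpick0 -dimv_eq0 (eqP dimU).
Qed.

Lemma proj_of_generator x : x != 0 -> exists P, val P = <[x]>%VS.
Proof.
move=> x0; have dimx : \dim <[x]> == 1%N by rewrite dim_vline x0.
by exists (exist (fun U : {vspace 'rV[K]_n} => \dim U == 1%N) _ dimx).
Qed.

Lemma proj_zeroE (p : {mpoly K[n]}) P x : val P = <[x]>%VS ->
  proj_zero p P <-> forall c, p.@[fun i => c * x 0 i] = 0.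
Proof.
move=> Px; split=> [pP c|pc y].
  rewrite -(pP (c *: x)); first by apply: meval_eq => i; rewrite mxE.
  by rewrite Px memvZ ?memv_line.
rewrite Px => /vlineP[c ->]; rewrite -(pc c).
by apply: meval_eq => i; rewrite mxE.
Qed.

End ProjectivePoints.

(** * Membership in the reciprocal plane *)

Section ReciprocalPlane.

Variables (R : realType) (d n : nat) (A : 'M[R]_(d, n)).

(** Homogeneity makes the zero locus closed, so only the points [1/u] need checking; there the claim
    is orthogonality of [L] to the kernel. *)
Lemma reciprocal_plane_sub (B : set 'cV[R]_n) :
  (forall v, B v -> A *m v = 0) ->
  (reciprocal_plane A `<=` zero_locus (circuit_polys B))%classic.
Proof.
move=> kerB; apply: smallest_sub.
  exists (circuit_polys B) => // _ [v _ ->].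
  by exists #|supp v|.-1; apply: circuit_poly_homog.
move=> P [u [uL u0 Pu]] _ [v /kerB vA ->].
apply/(proj_zeroE _ Pu) => c; rewrite circuit_poly_scale.
rewrite (@circuit_poly_recip _ _ _ _ (u 0)).
  by rewrite (complexify_orthogonal uL vA) !mulr0.
by move=> i _; rewrite mxE mulVf.
Qed.

Lemma reciprocal_plane_limit (P : proj R[i] n) (x u w : 'rV[R[i]]_n) :
  x != 0 -> val P = <[x]>%VS ->
  (u <= complexify A)%MS -> (w <= complexify A)%MS ->
  (forall i, x 0 i != 0 -> u 0 i = 0 /\ w 0 i * x 0 i = 1) ->
  (forall i, x 0 i = 0 -> u 0 i != 0) ->
  reciprocal_plane A P.
Proof.
move=> x0 Px uL wL xw xu Z [[S _ ->]] recS p Sp.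
apply/(proj_zeroE _ Px) => a.
apply: (@meval_recip_limit _ _ p (x 0) (u 0) (w 0) a) => // s c us0.
have us i : (u + s *: w) 0 i = u 0 i + s * w 0 i by rewrite !mxE.
pose y : 'rV[R[i]]_n := \row_i ((u + s *: w) 0 i)^-1.
have y0 : y != 0.
  have /rV0Pn[i _] := x0; apply/rV0Pn; exists i.
  by rewrite mxE us invr_neq0.
have [Q Qy] := proj_of_generator y0.
have /recS/(_ p Sp)/(proj_zeroE _ Qy)/(_ c) <- : reciprocal_points A Q.
  exists (u + s *: w); split=> // [|i]; last by rewrite us.
  by rewrite addmx_sub ?scalemx_sub.
by apply: meval_eq => i; rewrite mxE us.
Qed.

End ReciprocalPlane.

Theorem proposition21 (R : realType) (d n : nat) (A : 'M[R]_(d, n))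
    (rankA : \rank A = d) (colA : forall j : 'I_n, col j A != 0)
    (rep : {set 'I_n} -> 'cV[R]_n) (repA : circuit_choice A rep)
    (B : set 'cV[R]_n) (subB : (B `<=` circuit_vectors A rep)%classic) :
  zero_locus (circuit_polys B) = reciprocal_plane A
  <-> (forall J : {set 'I_n}, ~~ flat A J -> exists2 v, B v & exposes v J).
Proof.
have kerB v : B v -> A *m v = 0 by move=> /subB[C /repA[vA _] ->].
split=> [eqB J nfJ|expB]; last first.
  apply/seteqP; split=> [P PB|]; last exact: reciprocal_plane_sub.
  have [x x0 Px] := proj_generator P.
  pose J : {set 'I_n} := [set i | x 0 i != 0]%SET.
  have xJ i : (x 0 i == 0) = (i \notin J) by rewrite inE negbK.
  have hx v : B v -> (circuit_poly v).@[x 0] = 0.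
    move=> vB; have /(proj_zeroE _ Px)/(_ 1) <- : proj_zero (circuit_poly v) P.
      by apply: PB; exists v.
    by apply: meval_eq => i; rewrite mul1r.
  have fJ : flat A J.
    apply: contraT => /expB[v /hx vx vJ].
    by have := circuit_poly_exposed vJ xJ; rewrite vx eqxx.
  have [u uL uJ] := generic_vector_flat fJ.
  (* On the support of such a [v] no coordinate of [x] is zero, so [h_v(x) = 0] says that [v] is
     orthogonal to [1/x]. *)
  have [v vB vJ|w wL wJ] := row_space_extension (y := fun i => (x 0 i)^-1) kerB expB fJ.
    have xv i : i \in supp v -> x 0 i != 0.
      by move/(fintype.subsetP vJ); rewrite inE.
    have := hx v vB; rewrite (@circuit_poly_recip _ _ _ _ (fun i => (x 0 i)^-1)).
      move/eqP; rewrite mulf_eq0 => /orP; case=> [/prodf_eq0|/eqP//]; case=> i /xv/negPf -> //.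
    by move=> i /xv xi; rewrite divff.
  apply: (reciprocal_plane_limit x0 Px uL wL) => i.
    move=> xi; have iJ : i \in J by rewrite inE.
    by rewrite wJ // mulVf //; split=> //; apply/eqP; rewrite uJ.
  by move/eqP; rewrite xJ uJ.
apply: contrapT => nexpB.
have [v vA vJ] := nonflat_kernel nfJ.
have [u uL u0] := generic_vector_flat (flat_set0 colA).
have {}u0 i : u 0 i != 0 by rewrite u0 inE.
pose x : 'rV[R[i]]_n := \row_i (if i \in J then (u 0 i)^-1 else 0).
have xJ i : (x 0 i == 0) = (i \notin J).
  by rewrite mxE; case: ifP => _; rewrite ?eqxx // invr_eq0 (negPf (u0 i)).
have x0 : x != 0.
  (* A non-flat is nonempty, because without zero columns the empty set is a flat. *)
  apply: contraNneq nfJ => xz; suff -> : J = finset.set0 by apply: flat_set0.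
  apply/finset.setP => i; rewrite finset.in_set0.
  by have := xJ i; rewrite xz [X in X == 0]mxE eqxx; case: (i \in J).
have [P Px] := proj_of_generator x0.
have PB : zero_locus (circuit_polys B) P.
  move=> _ [b bB ->]; apply/(proj_zeroE _ Px) => c; rewrite circuit_poly_scale.
  rewrite (@circuit_poly_unexposed _ _ _ _ (u 0) J) ?mulr0 //.
  - by apply/negP => bJ; apply: nexpB; exists b.
  - by move=> i iJ; apply/eqP; rewrite xJ.
  - by move=> i iJ; rewrite mxE iJ mulVf.
  exact: (complexify_orthogonal uL (kerB b bB)).
(* Applied to the singleton of [v], the inclusion makes [h_v] vanish on the reciprocal plane, hence
   at [P]. *)
have kerv b : [set v]%classic b -> A *m b = 0 by move=> ->.
have : zero_locus (circuit_polys [set v]%classic) P.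
  by apply: (reciprocal_plane_sub kerv); rewrite -eqB.
move/(_ (circuit_poly v)) => /(_ (ex_intro2 _ _ v erefl erefl)).
move/(proj_zeroE _ Px)/(_ 1) => vx.
have /eqP[] := circuit_poly_exposed vJ xJ.
by rewrite -[RHS]vx; apply: meval_eq => i; rewrite mul1r.
Qed.
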